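(* Let $U$ be a nonempty open subset of $\mathbb{R}^d$ and $(x_n)_{n\ge1}$ a sequence in $\mathbb{R}^d$. Assume that for $\mathcal{L}^d$-almost every $x\in U$ there exist $\alpha(x)>0$ and an integer $\underline{j}(x)\ge0$ such that $\#\mathrm{M}((x_n)_{n\ge1};\lambda_{j_0}(x),j)\ge\alpha(x)2^{dj}$ for all integers $j_0,j\ge\underline{j}(x)$. Then $(x_n)_{n\ge1}$ is uniformly eutaxic in $U$.
   Context: Fix a norm $|\cdot|$ on $\mathbb{R}^d$; $\mathcal{L}^d$ is Lebesgue measure. $\mathrm{P}_d$ is the set of real sequences $(r_n)_{n\ge1}$ with $r_{n+1}\le r_n$ for all $n$, $r_n\to0$ and $\sum_n r_n^d=\infty$. A sequence $(x_n)$ in $\mathbb{R}^d$ is uniformly eutaxic in $U$ if for every $(r_n)\in\mathrm{P}_d$, $\mathcal{L}^d$-almost every $x\in U$ satisfies $|x-x_n|<r_n$ for infinitely many $n$. A dyadic cube is a set $\lambda=2^{-j}(k+[0,1)^d)$ with $j\in\mathbb{Z}$, $k\in\mathbb{Z}^d$; its generation is $\langle\lambda\rangle=j$; $\lambda_j(x)$ is the unique dyadic cube of generation $j$ containing $x$. For a nonempty dyadic cube $\lambda$ and an integer $j\ge0$, $\mathrm{M}((x_n)_{n\ge1};\lambda,j)$ is the set of dyadic cubes $\lambda'\subseteq\lambda$ of generation $\langle\lambda\rangle+j$ such that $x_n\in\lambda'$ for some $n\le2^{d\langle\lambda'\rangle}$. *)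

(* Defs.v *)
From Stdlib Require Import Reals ZArith List.
Require Stdlib.Vectors.Fin.
Open Scope R_scope.

Definition Rd (d : nat) := Fin.t d -> R.

Record is_norm (d : nat) (N : Rd d -> R) : Prop := {
  norm_nonneg : forall x, 0 <= N x;
  norm_definite : forall x, N x = 0 -> forall i, x i = 0;
  norm_homog : forall (c : R) x, N (fun i => c * x i) = Rabs c * N x;
  norm_triangle : forall x y, N (fun i => x i + y i) <= N x + N y }.

Definition is_open (d : nat) (U : Rd d -> Prop) : Prop :=
  forall x, U x -> exists r, 0 < r /\
    forall y, (forall i, Rabs (y i - x i) < r) -> U y.

Fixpoint prod_fin (d : nat) : (Fin.t d -> R) -> R :=
  match d with
  | O => fun _ => 1
  | S n => fun f => f Fin.F1 * prod_fin n (fun i => f (Fin.FS i))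
  end.

Definition box_vol (d : nat) (a b : Rd d) : R := prod_fin d (fun i => b i - a i).

Definition lebesgue_null (d : nat) (E : Rd d -> Prop) : Prop :=
  forall eps, 0 < eps ->
    exists a b : nat -> Rd d,
      (forall n i, a n i <= b n i) /\
      (forall x, E x -> exists n, forall i, a n i <= x i <= b n i) /\
      (forall m, sum_f_R0 (fun n => box_vol d (a n) (b n)) m <= eps).

Definition ae_in (d : nat) (U : Rd d -> Prop) (P : Rd d -> Prop) : Prop :=
  lebesgue_null d (fun x => U x /\ ~ P x).

(* The class P_d (sequences indexed by n >= 1). *)
Definition in_Pd (d : nat) (r : nat -> R) : Prop :=
  (forall n, (1 <= n)%nat -> r (S n) <= r n) /\
  (forall eps, 0 < eps -> exists N, forall n, (N <= n)%nat -> Rabs (r n) < eps) /\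
  (forall M, exists N, M < sum_f_R0 (fun n => r (S n) ^ d) N).

Definition uniformly_eutaxic (d : nat) (N : Rd d -> R) (xs : nat -> Rd d)
    (U : Rd d -> Prop) : Prop :=
  forall r, in_Pd d r ->
    ae_in d U (fun x => forall m, exists n, (m <= n)%nat /\ (1 <= n)%nat /\
                          N (fun i => x i - xs n i) < r n).

Definition in_cube (d : nat) (j : Z) (k : Fin.t d -> Z) (x : Rd d) : Prop :=
  forall i, powerRZ 2 (- j) * IZR (k i) <= x i < powerRZ 2 (- j) * (IZR (k i) + 1).

(* Membership of the cube of generation g+j with index k' in
   M((x_n); lambda, j) where lambda has generation g and index k. *)
Definition in_M (d : nat) (xs : nat -> Rd d) (g : Z) (k : Fin.t d -> Z) (j : nat)
    (k' : Fin.t d -> Z) : Prop :=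
  (forall y, in_cube d (g + Z.of_nat j) k' y -> in_cube d g k y) /\
  exists n, (1 <= n)%nat /\ INR n <= powerRZ 2 (Z.of_nat d * (g + Z.of_nat j)) /\
            in_cube d (g + Z.of_nat j) k' (xs n).

(* #M((x_n); lambda, j) >= c : there are at least c distinct cubes in M
   (cubes of the same generation are distinct iff their indices differ). *)
Definition card_M_ge (d : nat) (xs : nat -> Rd d) (g : Z) (k : Fin.t d -> Z) (j : nat)
    (c : R) : Prop :=
  exists L : list (Fin.t d -> Z),
    ForallOrdPairs (fun k1 k2 => exists i, k1 i <> k2 i) L /\
    Forall (in_M d xs g k j) L /\
    c <= INR (length L).

(* Main.v *)
(** A set E of missed points on which the hypothesis holds with uniform constants is covered by
    the dyadic cubes that meet it; in a cube lambda meeting E, a fixed proportion of the subcubes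
    of some generation must avoid E, and iterating this makes the total volume of the cover tend
    to 0.  If lambda lost less than that proportion, then at every generation j most of the cubes
    of M(lambda, j) meet E, and only few of them contain a point chosen at an earlier stage.  Around
    a point x_n in each remaining cube, the ball of radius r_n contains a smaller dyadic cube that
    avoids E, a hole.  Nestedness of dyadic cubes makes all these holes disjoint, while by Cauchy
    condensation the divergence of the sum of the r_n ^ d makes their total volume infinite.

    Dyadic cubes inside a base cube are encoded as pairs (j, q) with q < D ^ j, D = 2 ^ d, the
    parent of (j + 1, q) being (j, q / D). *)

Require Import Defs.
From Stdlib Require Import Reals ZArith List.
From Stdlib Require Import Lra Lia FinFun Cantor Classical ClassicalEpsilon FunctionalExtensionality.
Import ListNotations.
Open Scope R_scope.

(** * Counting in lists *)

Lemma choice_fun {A B : Type} (P : A -> B -> Prop) (b0 : B) (Q : A -> Prop) :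
  (forall a, Q a -> exists b, P a b) -> exists f : A -> B, forall a, Q a -> P a (f a).
Proof.
  intros H. exists (fun a => epsilon (inhabits b0) (P a)).
  intros a Ha. apply epsilon_spec, H, Ha.
Qed.

Definition pbool (P : Prop) : bool := if excluded_middle_informative P then true else false.

Lemma pboolP (P : Prop) : pbool P = true <-> P.
Proof. unfold pbool; destruct (excluded_middle_informative P); intuition discriminate. Qed.

Definition select {A : Type} (P : A -> Prop) (l : list A) : list A :=
  filter (fun x => pbool (P x)) l.

Definition count {A : Type} (P : A -> Prop) (l : list A) : nat := length (select P l).

Lemma in_select {A : Type} (P : A -> Prop) l x : In x (select P l) <-> In x l /\ P x.
Proof. unfold select. rewrite filter_In, pboolP. reflexivity. Qed.

Lemma NoDup_select {A : Type} (P : A -> Prop) l : NoDup l -> NoDup (select P l).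
Proof. apply NoDup_filter. Qed.

Lemma count_le_length {A : Type} (P : A -> Prop) l : (count P l <= length l)%nat.
Proof. apply filter_length_le. Qed.

Lemma count_app {A : Type} (P : A -> Prop) l1 l2 :
  count P (l1 ++ l2) = (count P l1 + count P l2)%nat.
Proof. unfold count, select. now rewrite filter_app, length_app. Qed.

Lemma count_cons {A : Type} (P : A -> Prop) x l :
  count P (x :: l) = ((if pbool (P x) then 1 else 0) + count P l)%nat.
Proof. unfold count, select; simpl; destruct (pbool (P x)); reflexivity. Qed.

(** Four alternatives suit [fresh_points], which keeps one kind of cell and discards three. *)
Lemma count_cover {A : Type} (P1 P2 P3 P4 : A -> Prop) l :
  (forall x, In x l -> P1 x \/ P2 x \/ P3 x \/ P4 x) ->
  (length l <= count P1 l + count P2 l + count P3 l + count P4 l)%nat.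
Proof.
  induction l as [|x l IH]; intros H; [simpl; lia|].
  rewrite !count_cons. simpl length.
  assert (IH' := IH (fun y Hy => H y (or_intror Hy))).
  destruct (H x (or_introl eq_refl)) as [Hx|[Hx|[Hx|Hx]]];
    apply pboolP in Hx; rewrite Hx;
    repeat match goal with |- context [pbool ?P] => destruct (pbool P) end; lia.
Qed.

Lemma NoDup_flat_map {A B : Type} (f : A -> list B) (l : list A) :
  NoDup l -> (forall a, In a l -> NoDup (f a)) ->
  (forall a a' b, In a l -> In a' l -> In b (f a) -> In b (f a') -> a = a') ->
  NoDup (flat_map f l).
Proof.
  induction 1 as [|a l Ha Hl IH]; intros Hf Hd; simpl; [constructor|].
  apply NoDup_app.
  - apply Hf; now left.
  - apply IH; intros; [apply Hf; now right|].
    eapply Hd; eauto; now right.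
  - intros b Hb Hb'. apply in_flat_map in Hb'. destruct Hb' as (a' & Ha' & Hb').
    assert (a = a') by (eapply Hd; eauto; [now left|now right]). now subst.
Qed.

Lemma pow_ge_1_nat (b n : nat) : (1 <= b)%nat -> (1 <= b ^ n)%nat.
Proof. intros H. assert (b ^ n <> 0)%nat by (apply Nat.pow_nonzero; lia). lia. Qed.

(** For [b = D ^ k] these are the codes of the descendants of cell [q], [k] generations down. *)
Definition block (q b : nat) : list nat := seq (q * b) b.

Lemma in_block q b w : (1 <= b)%nat -> In w (block q b) <-> (w / b)%nat = q.
Proof.
  intros Hb. unfold block. rewrite in_seq. split; intros H.
  - symmetry. apply (Nat.div_unique w b q (w - q * b)); lia.
  - subst q. pose proof (Nat.div_mod w b ltac:(lia)).
    pose proof (Nat.mod_upper_bound w b ltac:(lia)). lia.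
Qed.

Lemma NoDup_block_length q b l :
  (1 <= b)%nat -> NoDup l -> (forall w, In w l -> (w / b)%nat = q) -> (length l <= b)%nat.
Proof.
  intros Hb Hl H. replace b with (length (block q b)) by apply length_seq.
  apply NoDup_incl_length; [assumption|]. intros w Hw. now apply in_block, H.
Qed.

Lemma flat_map_block a n b :
  flat_map (fun q => block q b) (seq a n) = seq (a * b) (n * b).
Proof.
  revert a. induction n as [|n IH]; intros a; simpl; [reflexivity|].
  rewrite IH. unfold block. rewrite (seq_app b (n * b)).
  f_equal. f_equal. lia.
Qed.

Lemma count_flat_map {A B : Type} (P : B -> Prop) (f : A -> list B) (Q : A -> Prop) l (m : R) :
  0 <= m ->
  (forall a, In a l -> ~ Q a -> count P (f a) = 0%nat) ->
  (forall a, In a l -> Q a -> INR (count P (f a)) <= m) ->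
  INR (count P (flat_map f l)) <= INR (count Q l) * m.
Proof.
  intros Hm. induction l as [|a l IH]; intros H0 H1.
  - unfold count; simpl; lra.
  - simpl flat_map. rewrite count_app, count_cons, !plus_INR.
    specialize (IH (fun y Hy => H0 y (or_intror Hy)) (fun y Hy => H1 y (or_intror Hy))).
    destruct (classic (Q a)) as [Hq|Hq].
    + rewrite (proj2 (pboolP _) Hq).
      specialize (H1 a (or_introl eq_refl) Hq). simpl (INR 1). lra.
    + destruct (pbool (Q a)) eqn:E; [exfalso; apply Hq; now apply pboolP|].
      rewrite (H0 a (or_introl eq_refl) Hq). simpl (INR 0). lra.
Qed.

(** * Partial sums *)

(** Exactly [n] terms, whereas [sum_f_R0 f n] has [n + 1]; inductions can start from the empty
    sum. *)
Fixpoint psum (f : nat -> R) (n : nat) : R :=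
  match n with O => 0 | S k => psum f k + f k end.

Lemma sum_f_R0_psum f n : sum_f_R0 f n = psum f (S n).
Proof. induction n as [|n IH]; simpl in *; [ring|]. now rewrite IH. Qed.

Lemma psum_tail_le f a M n :
  (forall k, (a <= k)%nat -> f k <= M) -> psum f (a + n) <= psum f a + INR n * M.
Proof.
  intros H. induction n as [|n IH]; [rewrite Nat.add_0_r; simpl; lra|].
  rewrite Nat.add_succ_r, S_INR. simpl.
  specialize (H (a + n)%nat ltac:(lia)). lra.
Qed.

Lemma psum_monotone f a b :
  (forall k, 0 <= f k) -> (a <= b)%nat -> psum f a <= psum f b.
Proof.
  intros H. induction 1 as [|b _ IH]; [lra|]. simpl. specialize (H b). lra.
Qed.

Lemma psum_scale_le f g c u :
  (forall k, (k < u)%nat -> f k <= c * g k) -> psum f u <= c * psum g u.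
Proof.
  intros H. induction u as [|u IH]; simpl; [lra|].
  pose proof (H u ltac:(lia)). pose proof (IH (fun k Hk => H k ltac:(lia))). lra.
Qed.

Lemma antitone_from_1 (s : nat -> R) :
  (forall n, (1 <= n)%nat -> s (S n) <= s n) ->
  forall a b, (1 <= a <= b)%nat -> s b <= s a.
Proof.
  intros H a b [Ha Hab]. induction Hab as [|b Hab IH]; [lra|].
  specialize (H b ltac:(lia)). lra.
Qed.

(* Cauchy condensation along the geometric progression [a * B ^ v]. *)
Lemma condensation (s : nat -> R) (a B : nat) (K : R) :
  (1 <= a)%nat -> (2 <= B)%nat ->
  (forall n, (1 <= n)%nat -> 0 <= s n) ->
  (forall n, (1 <= n)%nat -> s (S n) <= s n) ->
  (forall u, psum (fun v => INR B ^ v * s (a * B ^ v)%nat) u <= K) ->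
  forall n, psum (fun k => s (S k)) n <= psum (fun k => s (S k)) a + INR a * INR B * K.
Proof.
  intros Ha HB Hpos Hdec HK n.
  assert (Hstep : forall u, psum (fun k => s (S k)) (a * B ^ u) <=
    psum (fun k => s (S k)) a + INR a * INR B * psum (fun v => INR B ^ v * s (a * B ^ v)%nat) u).
  { induction u as [|u IH]; [simpl; rewrite Nat.mul_1_r; lra|].
    pose proof (pow_ge_1_nat B u ltac:(lia)).
    replace (a * B ^ S u)%nat with (a * B ^ u + (a * B ^ S u - a * B ^ u))%nat
      by (rewrite Nat.pow_succ_r'; nia).
    (* Each added term is [s (S k)] with [S k] beyond [a * B ^ u], so it is at most
       [s (a * B ^ u)]. *)
    eapply Rle_trans.
    { apply psum_tail_le with (M := s (a * B ^ u)%nat). intros k Hk.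
      apply antitone_from_1; [assumption|nia]. }
    simpl psum.
    assert (INR (a * B ^ S u - a * B ^ u) <= INR a * INR B * INR B ^ u).
    { rewrite <- pow_INR, <- !mult_INR. apply le_INR. rewrite Nat.pow_succ_r'. nia. }
    assert (0 <= s (a * B ^ u)%nat) by (apply Hpos; nia).
    nra. }
  eapply Rle_trans; [apply (psum_monotone _ n (a * B ^ n))|].
  - intros k. apply Hpos. lia.
  - assert (n < B ^ n)%nat by (apply Nat.pow_gt_lin_r; lia). nia.
  - eapply Rle_trans; [apply Hstep|].
    apply Rplus_le_compat_l, Rmult_le_compat_l, HK.
    apply Rmult_le_pos; apply pos_INR.
Qed.

Lemma finite_upper_bound (f : nat -> nat) u : exists G, forall v, (v < u)%nat -> (f v <= G)%nat.
Proof.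
  induction u as [|u [G IH]]; [exists 0%nat; lia|].
  exists (Nat.max G (f u)). intros v Hv.
  destruct (Nat.eq_dec v u) as [->|]; [lia|]. specialize (IH v ltac:(lia)). lia.
Qed.

(** The least [i] with [/ INR D ^ i < x] works: minimality gives the upper bound on [x], and an [i]
    below [g] would contradict [x <= / INR D ^ g]. *)
Lemma inv_pow_bracket (D g : nat) (x : R) :
  (2 <= D)%nat -> 0 < x <= / INR D ^ g ->
  exists i, (g <= i)%nat /\ / INR D ^ i < x <= INR D * / INR D ^ i.
Proof.
  intros HD Hx.
  assert (HD' : 2 <= INR D) by (apply (le_INR 2); lia).
  destruct (pow_lt_1_zero (/ INR D)) with (y := x) as [k Hk]; [|lra|].
  { rewrite Rabs_pos_eq; [|left; apply Rinv_0_lt_compat; lra].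
    rewrite <- Rinv_1. apply Rinv_lt_contravar; lra. }
  specialize (Hk k (Nat.le_refl k)).
  rewrite pow_inv, Rabs_pos_eq in Hk by (left; apply Rinv_0_lt_compat, pow_lt; lra).
  induction k as [|k IH].
  - exfalso. assert (/ INR D ^ g <= 1).
    { rewrite <- Rinv_1. apply Rinv_le_contravar; [lra|]. apply pow_R1_Rle; lra. }
    simpl in Hk. lra.
  - destruct (Rlt_le_dec (/ INR D ^ k) x) as [Hlt|Hle]; [now apply IH|].
    exists (S k). repeat split; [|assumption|].
    + destruct (le_lt_dec g (S k)) as [|Hlt]; [assumption|exfalso].
      assert (/ INR D ^ g <= / INR D ^ S k).
      { apply Rinv_le_contravar; [apply pow_lt; lra|]. apply Rle_pow; [lra|lia]. }
      lra.
    + replace (INR D * / INR D ^ S k) with (/ INR D ^ k); [assumption|].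
      simpl. field. split; [apply pow_nonzero; lra|lra].
Qed.

(** * Subtrees of the D-adic tree *)

Section Trees.

Context (D : nat) (HD : (2 <= D)%nat).
(** In the application [T j q] says that the cell [(j, q)] contains a missed point, a property that
    passes to parents. *)
Context (T : nat -> nat -> Prop).
Context (HT : forall j q, T (S j) q -> T j (q / D)%nat).

Lemma tree_ancestor j k q : T (j + k) q -> T j (q / D ^ k)%nat.
Proof.
  revert q. induction k as [|k IH]; intros q H.
  - rewrite Nat.pow_0_r, Nat.div_1_r. now rewrite Nat.add_0_r in H.
  - rewrite Nat.add_succ_r in H. apply HT, IH in H.
    now rewrite Nat.Div0.div_div in H.
Qed.

(** The ratio [desc j q J / D ^ J] is the share of the volume of the cell [(j, q)] taken by the
    cover of generation [j + J]. *)
Definition desc (j q J : nat) : nat := count (T (j + J)) (block q (D ^ J)).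

Lemma desc_le j q J : (desc j q J <= D ^ J)%nat.
Proof.
  unfold desc. etransitivity; [apply count_le_length|].
  unfold block. now rewrite length_seq.
Qed.

(** A cell of the tree has all its ancestors in the tree, so only the cells counted by [desc j q J]
    can contribute descendants. *)
Lemma desc_refine j q J K c :
  0 <= c ->
  (forall q', T (j + J) q' -> INR (desc (j + J) q' K) <= c * INR D ^ K) ->
  INR (desc j q (J + K)) <= INR (desc j q J) * (c * INR D ^ K).
Proof.
  intros Hc H. unfold desc at 1.
  replace (block q (D ^ (J + K)))
    with (flat_map (fun q => block q (D ^ K)) (block q (D ^ J))).
  2:{ unfold block at 2 3. rewrite flat_map_block, Nat.pow_add_r. f_equal. lia. }
  apply count_flat_map.
  - apply Rmult_le_pos; [lra|]. apply pow_le, pos_INR.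
  - intros q' _ Hq'. unfold count. apply length_zero_iff_nil.
    destruct (select _ _) as [|w l] eqn:E; [reflexivity|exfalso].
    assert (Hw : In w (select (T (j + (J + K))) (block q' (D ^ K))))
      by (rewrite E; now left).
    apply in_select in Hw. destruct Hw as [Hw1 Hw2].
    apply in_block in Hw1; [|apply pow_ge_1_nat; lia].
    apply Hq'. rewrite <- Hw1. apply tree_ancestor.
    now rewrite <- Nat.add_assoc.
  - intros q' _ Hq'. specialize (H q' Hq'). unfold desc in H.
    now rewrite <- Nat.add_assoc in H.
Qed.

(** Refining with the trivial factor 1 never raises the surviving proportion, so a depth that works
    may be increased freely. *)
Lemma desc_ratio_antitone j q J K c :
  INR (desc j q J) <= c * INR D ^ J ->
  INR (desc j q (J + K)) <= c * INR D ^ (J + K).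
Proof.
  intros H.
  assert (INR (desc j q (J + K)) <= INR (desc j q J) * (1 * INR D ^ K)).
  { apply desc_refine; [lra|]. intros q' _.
    rewrite Rmult_1_l, <- pow_INR. apply le_INR, desc_le. }
  rewrite pow_add.
  assert (0 <= INR D ^ K) by apply pow_le, pos_INR. nra.
Qed.

(** Adding up the depths of finitely many cells gives one depth that serves them all. *)
Lemma uniform_depth c j n :
  (forall q, T j q -> exists J, INR (desc j q J) <= c * INR D ^ J) ->
  exists J, forall q, (q < n)%nat -> T j q -> INR (desc j q J) <= c * INR D ^ J.
Proof.
  intros H. induction n as [|n [J IH]]; [exists 0%nat; lia|].
  destruct (classic (T j n)) as [Hn|Hn].
  - destruct (H n Hn) as [J' HJ'].
    exists (J + J')%nat. intros q Hq Tq.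
    destruct (Nat.eq_dec q n) as [->|Hne].
    + rewrite Nat.add_comm. now apply desc_ratio_antitone.
    + apply desc_ratio_antitone, IH; [lia|assumption].
  - exists J. intros q Hq Tq. destruct (Nat.eq_dec q n) as [->|]; [contradiction|].
    apply IH; [lia|assumption].
Qed.

Lemma tree_lt j q : (forall q, T 0 q -> q = 0%nat) -> T j q -> (q < D ^ j)%nat.
Proof.
  intros H0 H. apply (tree_ancestor 0 j) in H. apply H0 in H.
  apply Nat.div_small_iff in H; [assumption|apply Nat.pow_nonzero; lia].
Qed.

(** A generation below the single root is finite, so a uniform depth exists for it; each such
    passage multiplies the surviving proportion by [c], and [c ^ t] tends to 0. *)
Lemma tree_vanishing c :
  0 <= c < 1 -> (forall q, T 0 q -> q = 0%nat) ->
  (forall j q, T j q -> exists J, INR (desc j q J) <= c * INR D ^ J) ->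
  forall eps, 0 < eps -> exists J, INR (desc 0 0 J) <= eps * INR D ^ J.
Proof.
  intros Hc H0 H eps Heps.
  assert (Hpow : forall t, exists J, INR (desc 0 0 J) <= c ^ t * INR D ^ J).
  { induction t as [|t [J IH]].
    - exists 0%nat. rewrite Rmult_1_l, <- pow_INR. apply le_INR, desc_le.
    - destruct (uniform_depth c J (D ^ J) (H J)) as [K HK].
      exists (J + K)%nat.
      assert (HR : INR (desc 0 0 (J + K)) <= INR (desc 0 0 J) * (c * INR D ^ K)).
      { apply desc_refine; [lra|]. simpl. intros q' Hq'. apply HK; [|assumption].
        now apply tree_lt. }
      assert (0 <= c * INR D ^ K) by (apply Rmult_le_pos; [lra|apply pow_le, pos_INR]).
      rewrite pow_add. simpl (c ^ S t). nra. }
  destruct (pow_lt_1_zero c) with (y := eps) as [t Ht]; [rewrite Rabs_pos_eq; lra|assumption|].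
  specialize (Ht t (Nat.le_refl t)). rewrite Rabs_pos_eq in Ht by (apply pow_le; lra).
  destruct (Hpow t) as [J HJ]. exists J.
  assert (0 <= INR D ^ J) by apply pow_le, pos_INR. nra.
Qed.

(** * Holes around the points of a sequence *)

Context (p m C : nat) (alpha : R) (good : nat -> Prop) (y : nat -> nat -> nat) (s : nat -> R).
Context (Halpha : 0 < alpha) (HC : (1 <= C)%nat).
(** Here [y n j] codes the cell of generation [j] around the [n]-th point, and [good n] says that
    this point lies in the base cube. *)
Context (Hy : forall n j, good n -> (y n (S j) / D)%nat = y n j).
Context (Hspos : forall n, (1 <= n)%nat -> 0 < s n).
Context (Hsdec : forall n, (1 <= n)%nat -> s (S n) <= s n).
Context (Hsdiv : forall M, exists n, M < psum (fun k => s (S k)) n).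
(** The number [s n] is the [d]-th power of the rescaled radius: a cell of volume below [s n] around
    the point fits in its ball, which missed points avoid once [n >= m]. *)
Context (Hhole : forall n i, (m <= n)%nat -> (1 <= n)%nat -> good n ->
  / INR D ^ i < s n -> ~ T i (y n i)).
(** The lower bound on M in coded form; the factor [C] accounts for generations being counted from
    that of the base cube. *)
Context (Hmany : forall j0 q j, T j0 q -> (p <= j)%nat -> exists L : list nat,
  NoDup L /\ alpha * INR D ^ j <= INR (length L) /\
  forall q', In q' L -> (q' / D ^ j)%nat = q /\
    exists n, (1 <= n <= C * D ^ (j0 + j))%nat /\ good n /\ y n (j0 + j)%nat = q').

Lemma level_ancestor n j k : good n -> (y n (j + k) / D ^ k)%nat = y n j.
Proof.
  intros Hn. induction k as [|k IH].
  - now rewrite Nat.pow_0_r, Nat.div_1_r, Nat.add_0_r.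
  - rewrite Nat.add_succ_r, <- IH, <- (Hy n (j + k) Hn). now rewrite Nat.Div0.div_div.
Qed.

Lemma div_pow_split w a b c : (a <= b <= c)%nat ->
  (w / D ^ (c - a))%nat = (w / D ^ (c - b) / D ^ (b - a))%nat.
Proof.
  intros H. rewrite Nat.Div0.div_div, <- Nat.pow_add_r. do 2 f_equal. lia.
Qed.

Section Node.

Context (j0 q : nat) (Hq : T j0 q).
(** The assumption to be refuted in this section: the node never loses a proportion [alpha / 4]. *)
Context (Hfull : forall J, (1 - alpha / 4) * INR D ^ J < INR (desc j0 q J)).

(** Of at least [alpha * D ^ j] cells of M, fewer than a quarter of that number miss the tree by
    [Hfull], and at most half lie in [X] or have a witness index below [m]; a quarter remains. *)
Lemma fresh_points j X :
  (p <= j)%nat -> INR m + INR (length X) <= alpha / 2 * INR D ^ j ->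
  exists L, NoDup L /\ alpha / 4 * INR D ^ j <= INR (length L) /\
    forall q', In q' L -> T (j0 + j) q' /\ ~ In q' X /\ (q' / D ^ j)%nat = q /\
      exists n, (m <= n)%nat /\ (1 <= n <= C * D ^ (j0 + j))%nat /\ good n /\
        y n (j0 + j)%nat = q'.
Proof.
  intros Hj HX. destruct (Hmany j0 q j Hq Hj) as (L0 & HL0 & Hlen & Hin).
  destruct (choice_fun (fun q' n => (1 <= n <= C * D ^ (j0 + j))%nat /\ good n /\
    y n (j0 + j)%nat = q') 0%nat (fun q' => In q' L0)) as [f Hf].
  { intros q' Hq'. now apply Hin. }
  pose (P1 := fun q' => T (j0 + j) q' /\ ~ In q' X /\ (m <= f q')%nat).
  pose (P2 := fun q' => ~ T (j0 + j) q').
  pose (P3 := fun q' => In q' X).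
  pose (P4 := fun q' => (f q' < m)%nat).
  assert (Hcov := count_cover P1 P2 P3 P4 L0).
  (* Cells of M missing the tree and descendants meeting it are disjoint parts of the block of
     [q]. *)
  assert (H2 : (count P2 L0 + desc j0 q j <= D ^ j)%nat).
  { unfold desc, count. rewrite <- length_app. apply NoDup_block_length with q;
      [apply pow_ge_1_nat; lia| |].
    - apply NoDup_app; try apply NoDup_select; [assumption|apply seq_NoDup|].
      intros a Ha Hb. apply in_select in Ha, Hb. now apply (proj2 Ha).
    - intros a Ha. apply in_app_or in Ha. destruct Ha as [Ha|Ha]; apply in_select in Ha.
      + now apply Hin.
      + apply in_block; [apply pow_ge_1_nat; lia|apply Ha]. }
  assert (H3 : (count P3 L0 <= length X)%nat).
  { apply NoDup_incl_length; [now apply NoDup_select|].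
    intros a Ha. now apply in_select in Ha. }
  (* Distinct cells with witness index below [m] are among the [m] cells of the first points. *)
  assert (H4 : (count P4 L0 <= m)%nat).
  { replace m with (length (map (fun n => y n (j0 + j)%nat) (seq 0 m)))
      by now rewrite length_map, length_seq.
    apply NoDup_incl_length; [now apply NoDup_select|].
    intros a Ha. apply in_select in Ha. destruct Ha as [Ha1 Ha2].
    apply in_map_iff. exists (f a). split; [now apply Hf|]. apply in_seq. unfold P4 in Ha2. lia. }
  exists (select P1 L0). split; [now apply NoDup_select|split].
  - assert (Hcov' : (length L0 <= count P1 L0 + count P2 L0 + count P3 L0 + count P4 L0)%nat).
    { apply Hcov. intros q' _. unfold P1, P2, P3, P4.
      destruct (classic (T (j0 + j) q')), (classic (In q' X)), (le_lt_dec m (f q')); tauto. }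
    apply le_INR in Hcov', H2, H3, H4. rewrite !plus_INR in Hcov'.
    rewrite plus_INR, pow_INR in H2.
    specialize (Hfull j). fold (count P1 L0). lra.
  - intros q' Hq'. apply in_select in Hq'. destruct Hq' as (Hq' & Ht & Hx & Hm).
    repeat split; try assumption; [now apply Hin|].
    exists (f q'). destruct (Hf q' Hq') as (Hn & Hg & He). now repeat split.
Qed.

(* [W] is a set of cells of generation [G] below the node, each inside a hole: a cell
   containing one of the points in [P] and missing the tree. *)
Definition holes (G : nat) (P W : list nat) : Prop :=
  NoDup W /\ forall w, In w W -> (w / D ^ (G - j0))%nat = q /\
    exists n i, In n P /\ (i <= G)%nat /\ good n /\ ~ T i (y n i) /\
      (w / D ^ (G - i))%nat = y n i.

(* A cell that meets the tree and contains no earlier point is disjoint from every earlier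
   hole: it cannot lie inside the hole, nor contain it. *)
Lemma add_holes j i G P W :
  (p <= j)%nat -> INR m + INR (length P) <= alpha / 2 * INR D ^ j ->
  (j0 + j <= i <= G)%nat -> / INR D ^ i < s (C * D ^ (j0 + j))%nat ->
  holes G P W ->
  exists P' W', holes G P' W' /\ (length P' <= length P + D ^ j)%nat /\
    INR (length W) + alpha / 4 * (INR D ^ j * INR D ^ (G - i)) <= INR (length W').
Proof.
  intros Hj HP Hi Hs [HW Hold].
  destruct (fresh_points j (map (fun n => y n (j0 + j)%nat) P)) as (L & HL & Hlen & Hin);
    [assumption|now rewrite length_map|].
  destruct (choice_fun (fun q' n => (m <= n)%nat /\ (1 <= n <= C * D ^ (j0 + j))%nat /\
    good n /\ y n (j0 + j)%nat = q') 0%nat (fun q' => In q' L)) as [f Hf].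
  { intros q' Hq'. now apply Hin. }
  assert (Hpow : forall k, (1 <= D ^ k)%nat) by (intros; apply pow_ge_1_nat; lia).
  (* The hole in [q'] is the cell of generation [i] around its chosen point, listed by its subcells
     of generation [G] so that holes of all stages are measured in one unit. *)
  pose (cells := fun q' => block (y (f q') i) (D ^ (G - i))).
  assert (Hcells : forall q' w, In q' L -> In w (cells q') ->
    (w / D ^ (G - i))%nat = y (f q') i /\ (w / D ^ (G - (j0 + j)))%nat = q').
  { intros q' w Hq' Hw. apply in_block in Hw; [|apply Hpow]. split; [assumption|].
    rewrite (div_pow_split _ _ i) by lia. rewrite Hw.
    destruct (Hf q' Hq') as (_ & _ & Hg & He). rewrite <- He at 2.
    rewrite <- (level_ancestor _ (j0 + j) (i - (j0 + j)) Hg). do 2 f_equal. lia. }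
  exists (map f L ++ P), (flat_map cells L ++ W). split; [split|split].
  - apply NoDup_app; [|assumption|].
    + apply NoDup_flat_map; [assumption|intros; apply seq_NoDup|].
      intros a a' b Ha Ha' Hb Hb'.
      rewrite <- (proj2 (Hcells a b Ha Hb)). now apply Hcells.
    + intros w Hw Hw'. apply in_flat_map in Hw. destruct Hw as (q' & Hq' & Hw).
      apply Hcells in Hw; [|assumption]. destruct Hw as [_ Hw].
      destruct (Hin q' Hq') as (HT' & HX & _ & _).
      destruct (Hold w Hw') as (_ & n & k & Hn & Hk & Hg & Hnt & Hwk).
      (* Either the old hole lies in [q'], and then so does its point, against freshness; or [q']
         lies in the old hole, which misses the tree. *)
      destruct (le_lt_dec (j0 + j) k) as [Hle|Hlt].
      * apply HX, in_map_iff. exists n. split; [|assumption].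
        rewrite <- Hw, (div_pow_split _ _ k) by lia. rewrite Hwk.
        rewrite <- (level_ancestor _ (j0 + j) (k - (j0 + j)) Hg). do 2 f_equal. lia.
      * apply Hnt. rewrite <- Hwk, (div_pow_split _ _ (j0 + j)) by lia. rewrite Hw.
        apply tree_ancestor. now replace (k + (j0 + j - k))%nat with (j0 + j)%nat by lia.
  - intros w Hw. apply in_app_or in Hw. destruct Hw as [Hw|Hw].
    + apply in_flat_map in Hw. destruct Hw as (q' & Hq' & Hw).
      apply Hcells in Hw; [|assumption]. destruct Hw as [Hw1 Hw2].
      destruct (Hf q' Hq') as (Hm & Hn & Hg & He).
      destruct (Hin q' Hq') as (_ & _ & Hd & _). split.
      * rewrite (div_pow_split _ _ (j0 + j)) by lia. rewrite Hw2, <- Hd. do 2 f_equal. lia.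
      * exists (f q'), i. repeat split; try assumption; [|lia|].
        -- apply in_or_app. left. now apply in_map.
        -- apply Hhole; [assumption|lia|assumption|].
           eapply Rlt_le_trans; [exact Hs|]. apply antitone_from_1; assumption.
    + destruct (Hold w Hw) as (Hwq & n & k & Hn & H'). split; [assumption|].
      exists n, k. split; [|assumption]. apply in_or_app. now right.
  - rewrite length_app, length_map.
    enough (length L <= D ^ j)%nat by lia.
    apply NoDup_block_length with q; [apply Hpow|assumption|]. intros a Ha. now apply Hin.
  - rewrite length_app, plus_INR.
    rewrite (flat_map_constant_length (c := (D ^ (G - i))%nat));
      [|intros; apply length_seq].
    rewrite mult_INR, (pow_INR D (G - i)).
    assert (0 <= INR D ^ (G - i)) by apply pow_le, pos_INR. nra.
Qed.

(** Otherwise a fresh cell would itself be a hole, although it meets the tree. Hence the holes can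
    be taken inside the fresh cells. *)
Lemma radius_below_cell j :
  (p <= j)%nat -> INR m <= alpha / 2 * INR D ^ j ->
  s (C * D ^ (j0 + j))%nat <= / INR D ^ (j0 + j).
Proof.
  intros Hj Hm. apply Rnot_lt_le. intros Hlt.
  destruct (fresh_points j []) as (L & _ & Hlen & Hin); [assumption|simpl; lra|].
  assert (0 < INR D ^ j) by (apply pow_lt, (lt_INR 0); lia).
  destruct L as [|q' L]; [simpl in Hlen; nra|].
  destruct (Hin q' (or_introl eq_refl)) as (HT' & _ & _ & n & Hmn & Hn & Hg & He).
  apply (Hhole n (j0 + j)); [assumption|lia|assumption| |now rewrite He].
  eapply Rlt_le_trans; [exact Hlt|]. apply antitone_from_1; assumption.
Qed.

Lemma holes_length G P W : (j0 <= G)%nat -> holes G P W -> (length W <= D ^ (G - j0))%nat.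
Proof.
  intros HG [HW Hin]. apply NoDup_block_length with q; [apply pow_ge_1_nat; lia|assumption|].
  intros w Hw. now apply Hin.
Qed.

(* Stages [t0, t0 + 1, ...] live in relative generation [St * t]; the step [St] is so large
   that all earlier stages together have few points compared with the next one. *)
Lemma stages St t0 (i : nat -> nat) G u :
  (1 <= St)%nat -> (p <= St)%nat -> (1 <= t0)%nat ->
  8 / alpha <= INR D ^ St -> INR m <= alpha / 4 * INR D ^ (St * t0) ->
  (forall v, (v < u)%nat -> (j0 + St * (t0 + v) <= i v <= G)%nat /\
    / INR D ^ i v < s (C * D ^ (j0 + St * (t0 + v)))%nat) ->
  exists P W, holes G P W /\ (length P * D ^ St <= 2 * D ^ (St * (t0 + u)))%nat /\
    alpha / 4 * psum (fun v => INR D ^ (St * (t0 + v)) * INR D ^ (G - i v)) u <= INR (length W).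
Proof.
  intros HSt Hp Ht0 HB Hm. induction u as [|u IH]; intros Hi.
  - exists [], []. split; [split; [constructor|simpl; tauto]|]. simpl. split; [lia|lra].
  - destruct IH as (P & W & Hh & HP & HW); [intros; apply Hi; lia|].
    destruct (Hi u ltac:(lia)) as [Hiu Hsu].
    assert (HD2 : 2 <= INR D) by (apply (le_INR 2); lia).
    destruct (add_holes (St * (t0 + u)) (i u) G P W) as (P' & W' & Hh' & HP' & HW');
      try assumption; [nia| |].
    (* The bound on [P] and [8 / alpha <= D ^ St] leave at most [alpha / 4 * D ^ (St * (t0 + u))]
       old points; [m] takes the other quarter. *)
    { assert (H1 : INR D ^ (St * t0) <= INR D ^ (St * (t0 + u))) by (apply Rle_pow; [lra|nia]).
      apply le_INR in HP. rewrite !mult_INR, !pow_INR in HP. simpl (INR 2) in HP.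
      assert (H2 : 0 < INR D ^ St) by (apply pow_lt; lra).
      assert (H3 : 8 <= alpha * INR D ^ St).
      { apply Rmult_le_compat_l with (r := alpha) in HB; [|lra].
        replace (alpha * (8 / alpha)) with 8 in HB by (field; lra). lra. }
      assert (H4 : 0 <= INR (length P)) by apply pos_INR.
      assert (8 * INR (length P) <= alpha * (2 * INR D ^ (St * (t0 + u)))) by nra.
      nra. }
    exists P', W'. split; [assumption|split].
    (* The factor 2 persists because [2 <= D ^ St]: the old points number at most the new allowance,
       as in a geometric sum. *)
    + replace (St * (t0 + S u))%nat with (St * (t0 + u) + St)%nat by lia.
      rewrite Nat.pow_add_r.
      assert (2 <= D ^ St)%nat.
      { etransitivity; [exact HD|]. rewrite <- (Nat.pow_1_r D) at 1. apply Nat.pow_le_mono_r; lia. }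
      nia.
    + simpl psum. lra.
Qed.

(** The disjoint holes of all stages fit in the node, which bounds the condensed series of the
    [s n]; by [condensation] the full series would then be bounded, against [Hsdiv]. *)
Lemma full_node_absurd : False.
Proof.
  assert (HD2 : 2 <= INR D) by (apply (le_INR 2); lia).
  assert (Hbig : forall x, exists n, forall k, (n <= k)%nat -> x <= INR D ^ k).
  { intros x. destruct (Pow_x_infinity (INR D)) with (b := x) as [n Hn].
    - rewrite Rabs_pos_eq; lra.
    - exists n. intros k Hk. specialize (Hn k Hk).
      rewrite Rabs_pos_eq in Hn by (apply pow_le; lra). lra. }
  destruct (Hbig (8 / alpha)) as [S1 HS1].
  (* [S1] yields [8 / alpha <= D ^ St], [p] passes the threshold of [Hmany], and 1 makes the step
     positive. *)
  pose (St := (S1 + p + 1)%nat).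
  destruct (Hbig (INR m * (4 / alpha))) as [t1 Ht1].
  pose (t0 := (t1 + 1)%nat).
  assert (Hm : forall t, (t0 <= t)%nat -> INR m <= alpha / 4 * INR D ^ (St * t)).
  { intros t Ht. assert (H := Ht1 (St * t)%nat ltac:(unfold St, t0 in *; nia)).
    apply Rmult_le_compat_l with (r := alpha / 4) in H; [|lra].
    replace (alpha / 4 * (INR m * (4 / alpha))) with (INR m) in H by (field; lra). exact H. }
  (* The holes of stage [v] have volume below [s] at the largest index of the stage, but by at most
     a factor [D]. *)
  assert (Hex : forall v, exists i, (j0 + St * (t0 + v) <= i)%nat /\
    / INR D ^ i < s (C * D ^ (j0 + St * (t0 + v)))%nat <= INR D * / INR D ^ i).
  { intros v. apply inv_pow_bracket; [exact HD|]. split.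
    - apply Hspos. pose proof (pow_ge_1_nat D (j0 + St * (t0 + v)) ltac:(lia)). nia.
    - apply radius_below_cell; [unfold St, t0; nia|].
      specialize (Hm (t0 + v)%nat ltac:(lia)).
      assert (0 <= INR D ^ (St * (t0 + v))) by (apply pow_le; lra). nra. }
  destruct (choice_fun _ 0%nat (fun _ => True) (fun v _ => Hex v)) as [i Hi].
  (* With these values [a * B ^ v] is the largest index allowed in stage [v]. *)
  pose (B := (D ^ St)%nat). pose (a := (C * D ^ (j0 + St * t0))%nat).
  assert (HB1 : (2 <= B)%nat).
  { unfold B. etransitivity; [exact HD|]. rewrite <- (Nat.pow_1_r D) at 1.
    apply Nat.pow_le_mono_r; unfold St; lia. }
  assert (Hab : forall v, (a * B ^ v = C * D ^ (j0 + St * (t0 + v)))%nat).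
  { intros v. unfold a, B. rewrite <- Nat.pow_mul_r, <- Nat.mul_assoc, <- Nat.pow_add_r.
    do 2 f_equal. lia. }
  (* In the constant, [4 / alpha] undoes the density of fresh cells and [D] the rounding of [s] to a
     power of [D]. *)
  destruct (Hsdiv (psum (fun k => s (S k)) a + INR a * INR B * (4 * INR D / alpha))) as [n Hn].
  apply Rlt_not_le in Hn. apply Hn. apply condensation; [|assumption| |assumption|].
  - unfold a. pose proof (pow_ge_1_nat D (j0 + St * t0) ltac:(lia)). nia.
  - intros k Hk. left. now apply Hspos.
  - clear n Hn. intros u.
    (* A generation finer than all holes of the first [u] stages and than the node. *)
    destruct (finite_upper_bound i u) as [G0 HG0]. pose (G := (G0 + j0)%nat).
    destruct (stages St t0 i G u) as (P & W & Hh & _ & HW);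
      try (unfold St, t0; lia).
    { apply HS1. unfold St. lia. }
    { apply Hm. lia. }
    { intros v Hv. specialize (HG0 v Hv). destruct (Hi v I) as (H1 & H2 & _).
      split; [unfold G; lia|assumption]. }
    apply holes_length in Hh; [|unfold G; lia].
    apply le_INR in Hh. rewrite pow_INR in Hh.
    assert (HG : INR D ^ (G - j0) <= INR D ^ G) by (apply Rle_pow; [lra|lia]).
    assert (HDG : 0 < INR D ^ G) by (apply pow_lt; lra).
    eapply Rle_trans.
    { apply psum_scale_le with (c := INR D / INR D ^ G)
        (g := fun v => INR D ^ (St * (t0 + v)) * INR D ^ (G - i v)).
      intros v Hv. rewrite Hab. unfold B. destruct (Hi v I) as (_ & _ & H3).
      specialize (HG0 v Hv).
      assert (HE : INR D ^ (G - i v) = INR D ^ G * / INR D ^ i v).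
      { replace G with ((G - i v) + i v)%nat at 2 by (unfold G; lia).
        rewrite pow_add. field. apply pow_nonzero; lra. }
      rewrite HE, pow_INR, <- pow_mult.
      replace (INR D / INR D ^ G * (INR D ^ (St * (t0 + v)) * (INR D ^ G * / INR D ^ i v)))
        with (INR D ^ (St * (t0 + v)) * (INR D * / INR D ^ i v))
        by (field; split; apply pow_nonzero; lra).
      apply Rmult_le_compat; try assumption.
      - apply pow_le; lra.
      - left. apply Hspos. pose proof (pow_ge_1_nat D (j0 + St * (t0 + v)) ltac:(lia)). nia.
      - apply Rle_pow; [lra|nia]. }
    set (x := psum _ _) in *.
    assert (Hx : x <= 4 / alpha * INR D ^ G).
    { apply Rmult_le_reg_l with (alpha / 4); [lra|].
      replace (alpha / 4 * (4 / alpha * INR D ^ G)) with (INR D ^ G) by (field; lra). lra. }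
    apply Rmult_le_compat_l with (r := INR D / INR D ^ G) in Hx.
    2:{ apply Rmult_le_pos; [lra|]. left. now apply Rinv_0_lt_compat. }
    eapply Rle_trans; [exact Hx|]. right. field. lra.
Qed.

End Node.

Lemma node_loses j q : T j q -> exists J, INR (desc j q J) <= (1 - alpha / 4) * INR D ^ J.
Proof.
  intros Hq. apply NNPP. intros H. apply (full_node_absurd j q Hq).
  intros J. apply Rnot_le_lt. intros HJ. apply H. now exists J.
Qed.

End Trees.

(** * Norms and null sets *)

Definition fcons {A : Type} {n : nat} (a : A) (v : Fin.t n -> A) : Fin.t (S n) -> A :=
  fun i => Fin.caseS' i (fun _ => A) a v.

Lemma fcons_eta {A : Type} {n : nat} (v : Fin.t (S n) -> A) :
  v = fcons (v Fin.F1) (fun i => v (Fin.FS i)).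
Proof.
  apply functional_extensionality. intros i. now apply (Fin.caseS' i).
Qed.

(** Induction on [d]: the restriction of [N] to vectors with first coordinate 0 inherits both
    properties, and the first coordinate adds at most [delta * Rabs (N e)]. *)
Lemma norm_le_sup d (N : Rd d -> R) :
  (forall (c : R) x, N (fun i => c * x i) = Rabs c * N x) ->
  (forall x y, N (fun i => x i + y i) <= N x + N y) ->
  exists K, 0 < K /\ forall x delta, (forall i, Rabs (x i) <= delta) -> 0 <= delta ->
    N x <= K * delta.
Proof.
  induction d as [|d IH]; intros Hh Ht.
  - exists 1. split; [lra|]. intros x delta _ Hdelta.
    replace x with (fun i : Fin.t 0 => 0 * x i)
      by (apply functional_extensionality; intros i; now apply (Fin.case0 (fun i => 0 * x i = x i))).
    rewrite Hh, Rabs_R0. lra.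
  - destruct (IH (fun v => N (fcons 0 v))) as (K & HK & Hsup).
    + intros c v. rewrite <- Hh. f_equal. apply functional_extensionality. intros i.
      apply (Fin.caseS' i); simpl; [ring|reflexivity].
    + intros v w. eapply Rle_trans; [right|apply Ht]. f_equal.
      apply functional_extensionality. intros i. apply (Fin.caseS' i); simpl; [ring|reflexivity].
    + pose (e := fcons 1 (fun _ : Fin.t d => 0)).
      exists (Rabs (N e) + K). split; [pose proof (Rabs_pos (N e)); lra|].
      intros x delta Hx Hdelta.
      replace x with (fun i => x Fin.F1 * e i + fcons 0 (fun i => x (Fin.FS i)) i).
      2:{ apply functional_extensionality. intros i.
          apply (Fin.caseS' i); [|intros i']; unfold e; simpl; ring. }
      eapply Rle_trans; [apply Ht|]. rewrite Hh.
      specialize (Hsup (fun i => x (Fin.FS i)) delta (fun i => Hx _) Hdelta). simpl in Hsup.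
      assert (Rabs (x Fin.F1) * N e <= delta * Rabs (N e)).
      { eapply Rle_trans; [apply Rmult_le_compat_l; [apply Rabs_pos|apply Rle_abs]|].
        apply Rmult_le_compat_r; [apply Rabs_pos|apply Hx]. }
      lra.
Qed.

Lemma prod_fin_nonneg d (f : Fin.t d -> R) : (forall i, 0 <= f i) -> 0 <= prod_fin d f.
Proof.
  induction d as [|d IH]; intros H; simpl; [lra|].
  apply Rmult_le_pos; [apply H|]. apply IH. intros; apply H.
Qed.

Lemma prod_fin_const d c : prod_fin d (fun _ => c) = c ^ d.
Proof. induction d as [|d IH]; simpl; [reflexivity|]. now rewrite IH. Qed.

(** * Sums over lists and countable covers *)

Definition lsum {A : Type} (f : A -> R) (l : list A) : R :=
  fold_right (fun x acc => f x + acc) 0 l.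

Lemma lsum_app {A : Type} (f : A -> R) l1 l2 : lsum f (l1 ++ l2) = lsum f l1 + lsum f l2.
Proof. induction l1 as [|x l1 IH]; simpl; [ring|]. rewrite IH. ring. Qed.

Lemma lsum_nonneg {A : Type} (f : A -> R) l : (forall x, 0 <= f x) -> 0 <= lsum f l.
Proof. intros H. induction l as [|x l IH]; simpl; [lra|]. specialize (H x). lra. Qed.

Lemma lsum_incl {A : Type} (f : A -> R) l l' :
  (forall x, 0 <= f x) -> NoDup l -> incl l l' -> lsum f l <= lsum f l'.
Proof.
  intros Hf Hl. revert l'. induction Hl as [|x l Hx Hl IH]; intros l' Hi.
  - now apply lsum_nonneg.
  - destruct (in_split x l' (Hi x (or_introl eq_refl))) as (l1 & l2 & ->).
    assert (lsum f l <= lsum f (l1 ++ l2)).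
    { apply IH. intros z Hz. specialize (Hi z (or_intror Hz)).
      apply in_app_or in Hi. apply in_or_app. destruct Hi as [|[->|]]; tauto. }
    rewrite !lsum_app in *. simpl. lra.
Qed.

Lemma lsum_map {A B : Type} (f : B -> R) (g : A -> B) l :
  lsum f (map g l) = lsum (fun x => f (g x)) l.
Proof. induction l as [|x l IH]; simpl; [reflexivity|]. now rewrite IH. Qed.

Lemma lsum_le {A : Type} (f g : A -> R) l :
  (forall x, f x <= g x) -> lsum f l <= lsum g l.
Proof. intros H. induction l as [|x l IH]; simpl; [lra|]. specialize (H x). lra. Qed.

Lemma lsum_list_prod {A B : Type} (f : A * B -> R) l l' :
  lsum f (list_prod l l') = lsum (fun a => lsum (fun b => f (a, b)) l') l.
Proof.
  induction l as [|x l IH]; simpl; [reflexivity|]. now rewrite lsum_app, lsum_map, IH.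
Qed.

Lemma psum_lsum f n : psum f n = lsum f (seq 0 n).
Proof.
  induction n as [|n IH]; [reflexivity|].
  rewrite seq_S, lsum_app. simpl. rewrite IH. ring.
Qed.

(** Both coordinates of [of_nat k] are at most [k], so the first [n] pairs lie in an [n] by [n]
    square, which is summed row by row. *)
Lemma psum_pairing_le (f : nat * nat -> R) (c : nat -> R) (C : R) :
  (forall z, 0 <= f z) ->
  (forall a n, psum (fun b => f (a, b)) n <= c a) ->
  (forall n, psum c n <= C) ->
  forall n, psum (fun k => f (of_nat k)) n <= C.
Proof.
  intros Hf Hc HC n. rewrite psum_lsum, <- (lsum_map f of_nat).
  eapply Rle_trans.
  { apply lsum_incl with (l' := list_prod (seq 0 n) (seq 0 n)); [assumption| |].
    - apply Injective_map_NoDup; [exact of_nat_inj|apply seq_NoDup].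
    - intros [a b] H. apply in_map_iff in H. destruct H as (k & Hk & Hin).
      apply in_seq in Hin. pose proof (to_nat_non_decreasing a b) as Hle.
      rewrite <- Hk, cancel_to_of in Hle. apply in_prod; apply in_seq; lia. }
  rewrite lsum_list_prod. eapply Rle_trans; [|apply (HC n)]. rewrite psum_lsum.
  apply lsum_le. intros a. rewrite <- psum_lsum. apply Hc.
Qed.

Lemma psum_geometric eps n : 0 <= eps -> psum (fun k => eps * (/ 2) ^ S k) n <= eps.
Proof.
  intros H.
  assert (E : psum (fun k => eps * (/ 2) ^ S k) n = eps * (1 - (/ 2) ^ n)).
  { clear H. induction n as [|n IH]; [simpl; ring|]. simpl psum in *. rewrite IH. simpl. field. }
  rewrite E. assert (0 <= (/ 2) ^ n) by (apply pow_le; lra). nra.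
Qed.

Lemma null_subset d (E F : Rd d -> Prop) :
  (forall x, E x -> F x) -> lebesgue_null d F -> lebesgue_null d E.
Proof.
  intros H HF eps Heps. destruct (HF eps Heps) as (a & b & Hab & Hcov & Hsum).
  exists a, b. split; [assumption|split; [|assumption]]. intros x Hx. now apply Hcov, H.
Qed.

Lemma null_union d (E : nat -> Rd d -> Prop) :
  (forall n, lebesgue_null d (E n)) -> lebesgue_null d (fun x => exists n, E n x).
Proof.
  intros H eps Heps.
  pose (cover := fun n (ab : (nat -> Rd d) * (nat -> Rd d)) =>
    (forall k i, fst ab k i <= snd ab k i) /\
    (forall x, E n x -> exists k, forall i, fst ab k i <= x i <= snd ab k i) /\
    (forall m, sum_f_R0 (fun k => box_vol d (fst ab k) (snd ab k)) m <= eps * (/ 2) ^ S n)).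
  destruct (choice_fun cover (fun _ _ => 0, fun _ _ => 0) (fun _ => True)) as [g Hg].
  { intros n _. destruct (H n (eps * (/ 2) ^ S n)) as (a & b & Hab).
    - apply Rmult_lt_0_compat; [assumption|apply pow_lt; lra].
    - now exists (a, b). }
  exists (fun k => fst (g (fst (of_nat k))) (snd (of_nat k))),
         (fun k => snd (g (fst (of_nat k))) (snd (of_nat k))).
  split; [|split].
  - intros k. now apply Hg.
  - intros x [n Hx]. destruct (proj1 (proj2 (Hg n I)) x Hx) as [k Hk].
    exists (to_nat (n, k)). now rewrite cancel_of_to.
  - intros m. rewrite sum_f_R0_psum.
    pose (f := fun z : nat * nat => box_vol d (fst (g (fst z)) (snd z)) (snd (g (fst z)) (snd z))).
    assert (Hf : forall z, 0 <= f z).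
    { intros z. apply prod_fin_nonneg. intros i.
      pose proof (proj1 (Hg (fst z) I) (snd z) i). lra. }
    apply (psum_pairing_le f (fun k => eps * (/ 2) ^ S k)); [assumption| |].
    + intros a [|n]; [simpl; apply Rmult_le_pos; [lra|]; apply Rmult_le_pos; [lra|apply pow_le; lra]|].
      rewrite <- sum_f_R0_psum. apply (Hg a I).
    + intros n. apply psum_geometric. lra.
Qed.

Lemma null_of_finite_cubes d (E : Rd d -> Prop) :
  (1 <= d)%nat ->
  (forall eps, 0 < eps -> exists (h : R) (l : list (Rd d)), 0 <= h /\
    INR (length l) * h ^ d <= eps /\
    forall x, E x -> exists a, In a l /\ forall i, a i <= x i <= a i + h) ->
  lebesgue_null d E.
Proof.
  intros Hd H eps Heps. destruct (H eps Heps) as (h & l & Hh & Hvol & Hcov).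
  pose (a := fun n => nth n l (fun _ => 0)).
  (* Past the end of the list the boxes degenerate to points, of volume 0 since [1 <= d]. *)
  pose (w := fun n => if (n <? length l)%nat then h else 0).
  exists a, (fun n i => a n i + w n). split; [|split].
  - intros n i. unfold w. destruct (n <? length l)%nat; lra.
  - intros x Hx. destruct (Hcov x Hx) as (c & Hc & Hin).
    destruct (In_nth l c (fun _ => 0) Hc) as (n & Hn & Hnth).
    exists n. intros i. unfold a, w. rewrite Hnth.
    apply Nat.ltb_lt in Hn. rewrite Hn. apply Hin.
  - intros m. eapply Rle_trans; [|exact Hvol]. rewrite sum_f_R0_psum.
    assert (Hmin : forall n, psum (fun n => box_vol d (a n) (fun i => a n i + w n)) n
                             <= INR (Nat.min n (length l)) * h ^ d).
    { induction n as [|n IH]; [simpl; lra|]. simpl psum.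
      assert (Hb : box_vol d (a n) (fun i => a n i + w n) = w n ^ d).
      { unfold box_vol. rewrite <- prod_fin_const. f_equal.
        apply functional_extensionality. intros i. ring. }
      rewrite Hb. change (w n) with (if (n <? length l)%nat then h else 0).
      destruct (n <? length l)%nat eqn:E0.
      - apply Nat.ltb_lt in E0. rewrite Nat.min_l in IH by lia. rewrite Nat.min_l by lia.
        rewrite S_INR. lra.
      - apply Nat.ltb_ge in E0. rewrite Nat.min_r in IH by lia. rewrite Nat.min_r by lia.
        rewrite pow_i by lia. lra. }
    eapply Rle_trans; [apply Hmin|]. apply Rmult_le_compat_r; [now apply pow_le|].
    apply le_INR. lia.
Qed.

(** * Encoding of dyadic cubes *)

Definition zenum (n : nat) : Z := (Z.of_nat (fst (of_nat n)) - Z.of_nat (snd (of_nat n)))%Z.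

Lemma zenum_surj z : exists n, zenum n = z.
Proof.
  exists (to_nat (Z.to_nat z, Z.to_nat (- z))). unfold zenum. rewrite cancel_of_to. simpl. lia.
Qed.

(** An enumeration of all cube indices, which makes the union over base cubes countable. *)
Fixpoint zvec (d : nat) (n : nat) : Fin.t d -> Z :=
  match d with
  | O => fun _ => 0%Z
  | S e => fcons (zenum (fst (of_nat n))) (zvec e (snd (of_nat n)))
  end.

Lemma zvec_surj d (k : Fin.t d -> Z) : exists n, zvec d n = k.
Proof.
  induction d as [|d IH].
  - exists 0%nat. apply functional_extensionality. intros i.
    now apply (Fin.case0 (fun i => zvec 0 0 i = k i)).
  - destruct (IH (fun i => k (Fin.FS i))) as [b Hb]. destruct (zenum_surj (k Fin.F1)) as [a Ha].
    exists (to_nat (a, b)). cbn [zvec]. rewrite cancel_of_to. simpl. rewrite Ha, Hb.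
    symmetry. apply fcons_eta.
Qed.

(** The index of the cube $\lambda_g(x)$; membership in a cube becomes an equation. *)
Definition cell_index {d : nat} (g : nat) (x : Rd d) : Fin.t d -> Z :=
  fun i => Int_part (2 ^ g * x i).

Lemma powerRZ_2_neg_nat g : powerRZ 2 (- Z.of_nat g) = / 2 ^ g.
Proof. now rewrite powerRZ_neg', <- pow_powerRZ. Qed.

Lemma cell_index_bounds d g (x : Rd d) i :
  IZR (cell_index g x i) <= 2 ^ g * x i < IZR (cell_index g x i) + 1.
Proof. unfold cell_index. pose proof (base_Int_part (2 ^ g * x i)). lra. Qed.

Lemma in_cube_iff d g k (x : Rd d) : in_cube d (Z.of_nat g) k x <-> cell_index g x = k.
Proof.
  unfold in_cube. rewrite powerRZ_2_neg_nat.
  assert (Hg : 0 < 2 ^ g) by (apply pow_lt; lra).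
  assert (Hinv : forall u, / 2 ^ g * (2 ^ g * u) = u) by (intros; field; lra).
  split; intros H.
  - apply functional_extensionality. intros i. symmetry. apply Int_part_spec.
    specialize (H i). split.
    + apply Rmult_lt_reg_l with (/ 2 ^ g); [now apply Rinv_0_lt_compat|].
      rewrite Rmult_minus_distr_l, Hinv. lra.
    + apply Rmult_le_reg_l with (/ 2 ^ g); [now apply Rinv_0_lt_compat|]. rewrite Hinv. lra.
  - subst k. intros i. pose proof (cell_index_bounds d g x i) as [H1 H2].
    rewrite <- (Hinv (x i)). apply Rinv_0_lt_compat in Hg. split.
    + apply Rmult_le_compat_l; lra.
    + apply Rmult_lt_compat_l; lra.
Qed.

Lemma cell_index_half d g (x : Rd d) :
  cell_index g x = fun i => (cell_index (S g) x i / 2)%Z.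
Proof.
  apply functional_extensionality. intros i. symmetry. apply Int_part_spec.
  pose proof (cell_index_bounds d (S g) x i) as H. simpl pow in H.
  set (z := cell_index (S g) x i) in *.
  assert (H1 : (2 * (z / 2) <= z <= 2 * (z / 2) + 1)%Z)
    by (pose proof (Z.div_mod z 2); pose proof (Z.mod_pos_bound z 2); lia).
  destruct H1 as [H1 H2]. apply IZR_le in H1, H2. rewrite plus_IZR in H2. rewrite !mult_IZR in *.
  lra.
Qed.

Lemma cell_index_ancestor d g j (x : Rd d) :
  cell_index g x = fun i => (cell_index (g + j) x i / 2 ^ Z.of_nat j)%Z.
Proof.
  induction j as [|j IH].
  - apply functional_extensionality. intros i. now rewrite Nat.add_0_r, Z.div_1_r.
  - rewrite IH, (cell_index_half d (g + j)), <- Nat.add_succ_r.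
    apply functional_extensionality. intros i.
    rewrite Z.div_div, Nat2Z.inj_succ, Z.pow_succ_r by lia. reflexivity.
Qed.

Lemma cell_index_coarser d g j (x y : Rd d) :
  cell_index (g + j) x = cell_index (g + j) y -> cell_index g x = cell_index g y.
Proof. intros H. now rewrite (cell_index_ancestor d g j x), H, <- cell_index_ancestor. Qed.

(** The position of a cube among the [2 ^ d] children of its parent. *)
Fixpoint parities (d : nat) : (Fin.t d -> Z) -> nat :=
  match d with
  | O => fun _ => 0%nat
  | S e => fun k => (Nat.b2n (Z.odd (k Fin.F1)) + 2 * parities e (fun i => k (Fin.FS i)))%nat
  end.

Lemma parities_lt d k : (parities d k < 2 ^ d)%nat.
Proof.
  induction d as [|d IH]; simpl; [lia|]. specialize (IH (fun i => k (Fin.FS i))).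
  destruct (Z.odd _); simpl; lia.
Qed.

Lemma parities_inj d k k' i : parities d k = parities d k' -> Z.odd (k i) = Z.odd (k' i).
Proof.
  induction i as [d|d i IH]; simpl; intros H.
  - destruct (Z.odd (k Fin.F1)), (Z.odd (k' Fin.F1)); simpl in H; try reflexivity; lia.
  - apply (IH (fun i => k (Fin.FS i)) (fun i => k' (Fin.FS i))).
    destruct (Z.odd (k Fin.F1)), (Z.odd (k' Fin.F1)); simpl in H; lia.
Qed.

(* Morton (Z-order) code: interleaves the [j] lowest binary digits of the coordinates, so that
   passing from a dyadic cube to its parent is division by [2 ^ d]. *)
Fixpoint morton (d j : nat) (k : Fin.t d -> Z) : nat :=
  match j with
  | O => 0%nat
  | S j' => (morton d j' (fun i => (k i / 2)%Z) * 2 ^ d + parities d k)%nat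
  end.

Lemma morton_parent d j k : (morton d (S j) k / 2 ^ d)%nat = morton d j (fun i => (k i / 2)%Z).
Proof.
  simpl. symmetry. apply (Nat.div_unique _ _ _ (parities d k)); [apply parities_lt|]. lia.
Qed.

(** The code retains the [j] lowest digits of each coordinate; the hypothesis on the quotients fixes
    the remaining ones. *)
Lemma morton_inj d j k k' :
  (forall i, (k i / 2 ^ Z.of_nat j = k' i / 2 ^ Z.of_nat j)%Z) ->
  morton d j k = morton d j k' -> k = k'.
Proof.
  revert k k'. induction j as [|j IH]; intros k k' Ht Hm.
  - apply functional_extensionality. intros i. specialize (Ht i).
    simpl in Ht. now rewrite !Z.div_1_r in Ht.
  - assert (Hh : (fun i => k i / 2)%Z = (fun i => k' i / 2)%Z).
    { apply IH.
      - intros i. specialize (Ht i). rewrite Nat2Z.inj_succ, Z.pow_succ_r in Ht by lia.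
        rewrite !Z.div_div by lia. exact Ht.
      - rewrite <- !morton_parent. now rewrite Hm. }
    simpl in Hm. rewrite Hh in Hm.
    apply functional_extensionality. intros i.
    apply f_equal with (f := fun v => v i) in Hh. simpl in Hh.
    assert (Ho : Z.odd (k i) = Z.odd (k' i)) by (apply parities_inj; lia).
    rewrite (Z.div_mod (k i) 2), (Z.div_mod (k' i) 2), Hh, !Zmod_odd, Ho by lia.
    reflexivity.
Qed.

Definition code {d : nat} (p j : nat) (x : Rd d) : nat := morton d j (cell_index (p + j) x).

Lemma code_parent d p j (x : Rd d) : (code p (S j) x / 2 ^ d)%nat = code p j x.
Proof.
  unfold code. rewrite morton_parent, Nat.add_succ_r. now rewrite <- cell_index_half.
Qed.

Lemma code_inj d p j (x y : Rd d) :
  cell_index p x = cell_index p y -> code p j x = code p j y ->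
  cell_index (p + j) x = cell_index (p + j) y.
Proof.
  intros Hp Hc. apply morton_inj with j; [|exact Hc]. intros i.
  rewrite (cell_index_ancestor d p j x), (cell_index_ancestor d p j y) in Hp.
  exact (f_equal (fun v => v i) Hp).
Qed.

(** * Positivity of the radii and auxiliary facts *)

Lemma pow_lt_inv (a b : R) n : 0 <= b -> a ^ n < b ^ n -> a < b.
Proof.
  intros Hb H. apply Rnot_le_lt. intros Hba. pose proof (pow_incr b a n (conj Hb Hba)). lra.
Qed.

(** A negative term would keep the sequence away from 0; a zero term would annihilate all later
    terms and bound the divergent sum. *)
Lemma in_Pd_pos d r : (1 <= d)%nat -> in_Pd d r -> forall n, (1 <= n)%nat -> 0 < r n.
Proof.
  intros Hd (Hdec & Hlim & Hdiv).
  assert (Hanti := antitone_from_1 r Hdec).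
  assert (Hnn : forall n, (1 <= n)%nat -> 0 <= r n).
  { intros n Hn. apply Rnot_lt_le. intros Hneg.
    destruct (Hlim (- r n)) as [k Hk]; [lra|].
    specialize (Hk (n + k)%nat ltac:(lia)). specialize (Hanti n (n + k)%nat ltac:(lia)).
    apply Rabs_def2 in Hk. lra. }
  intros n Hn. destruct (Hnn n Hn) as [|H0]; [assumption|exfalso].
  destruct (Hdiv (psum (fun k => r (S k) ^ d) n)) as [k Hk].
  rewrite sum_f_R0_psum in Hk.
  assert (Hpos : forall k, 0 <= r (S k) ^ d) by (intros; apply pow_le, Hnn; lia).
  pose proof (psum_monotone _ (S k) (n + S k) Hpos ltac:(lia)).
  assert (psum (fun k => r (S k) ^ d) (n + S k) <= psum (fun k => r (S k) ^ d) n + INR (S k) * 0).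
  { apply psum_tail_le. intros l Hl.
    assert (r (S l) = 0) as ->.
    { apply Rle_antisym; [rewrite H0; apply Hanti; lia|apply Hnn; lia]. }
    rewrite pow_i by lia. lra. }
  lra.
Qed.

Lemma psum_mult c f n : psum (fun k => c * f k) n = c * psum f n.
Proof. induction n as [|n IH]; simpl; [ring|]. rewrite IH. ring. Qed.

Lemma map_NoDup_of_pairs {A B : Type} (f : A -> B) (R : A -> A -> Prop) l :
  ForallOrdPairs R l -> (forall a b, In a l -> In b l -> R a b -> f a <> f b) -> NoDup (map f l).
Proof.
  induction 1 as [|a l Ha _ IH]; intros Hf; simpl; constructor.
  - intros Hin. apply in_map_iff in Hin. destruct Hin as (b & Hb & Hbl).
    rewrite Forall_forall in Ha. apply (Hf a b); [now left|now right|now apply Ha|now symmetry].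
  - apply IH. intros b c Hb Hc. apply Hf; now right.
Qed.

(** * The missed points form a null set *)

(* The single integer [p] serves as generation of the base cube, as threshold for all indices
   and as inverse of the density alpha, so that countably many pairs [(p, k0)] suffice. *)
Definition missed (d : nat) (N : Rd d -> R) (xs : nat -> Rd d) (r : nat -> R)
    (p : nat) (k0 : Fin.t d -> Z) (x : Rd d) : Prop :=
  cell_index p x = k0 /\
  (forall n, (p <= n)%nat -> (1 <= n)%nat -> r n <= N (fun i => x i - xs n i)) /\
  (forall j0 j, (p <= j0)%nat -> (p <= j)%nat -> forall k, in_cube d (Z.of_nat j0) k x ->
     card_M_ge d xs (Z.of_nat j0) k j (/ INR (S p) * 2 ^ (d * j))).

(** Supplies [Hmany]: the index bound [2 ^ (d * (p + j0 + j))] splits into [2 ^ (d * p)], due to the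
    base cube, and a power of [2 ^ d]. *)
Lemma many_cells d N xs r p k0 j0 j (x : Rd d) :
  missed d N xs r p k0 x -> (p <= j)%nat ->
  exists L : list nat, NoDup L /\ / INR (S p) * INR (2 ^ d) ^ j <= INR (length L) /\
    forall q', In q' L -> (q' / (2 ^ d) ^ j)%nat = code p j0 x /\
      exists n, (1 <= n <= 2 ^ (d * p) * (2 ^ d) ^ (j0 + j))%nat /\
        cell_index p (xs n) = k0 /\ code p (j0 + j) (xs n) = q'.
Proof.
  intros (Hk0 & _ & Hx) Hj.
  destruct (Hx (p + j0)%nat j ltac:(lia) Hj (cell_index (p + j0) x)) as (L & Hd & Hin & Hlen).
  { now apply in_cube_iff. }
  rewrite Forall_forall in Hin.
  assert (Hcell : forall k', In k' L -> exists n,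
    (1 <= n <= 2 ^ (d * p) * (2 ^ d) ^ (j0 + j))%nat /\
    cell_index (p + j0 + j) (xs n) = k' /\ cell_index (p + j0) (xs n) = cell_index (p + j0) x).
  { intros k' Hk'. destruct (Hin k' Hk') as (Hsub & n & Hn & Hle & Hcube).
    exists n. assert (Hc := Hsub _ Hcube). rewrite <- Nat2Z.inj_add in Hcube, Hle.
    rewrite <- Nat2Z.inj_mul, <- pow_powerRZ in Hle.
    split; [split; [assumption|]|split; now apply in_cube_iff].
    apply INR_le. eapply Rle_trans; [exact Hle|]. right.
    rewrite <- Nat.pow_mul_r, <- Nat.pow_add_r, pow_INR. simpl (INR 2). f_equal. lia. }
  exists (map (morton d (j0 + j)) L). split; [|split].
  (* Codes separate these cubes because all of them lie in one cube of generation [p + j0], hence in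
     one base cube. *)
  - apply map_NoDup_of_pairs with (1 := Hd). intros k1 k2 H1 H2 [i Hi] Hm. apply Hi.
    destruct (Hcell k1 H1) as (n1 & _ & <- & E1). destruct (Hcell k2 H2) as (n2 & _ & <- & E2).
    rewrite <- Nat.add_assoc in *.
    rewrite (code_inj d p (j0 + j) (xs n1) (xs n2)); [reflexivity| |exact Hm].
    apply cell_index_coarser with j0. now rewrite E1, E2.
  - rewrite length_map. rewrite pow_INR, <- pow_mult. exact Hlen.
  - intros q' Hq'. apply in_map_iff in Hq'. destruct Hq' as (k' & <- & Hk').
    destruct (Hcell k' Hk') as (n & Hn & <- & En).
    assert (Hcode : morton d (j0 + j) (cell_index (p + j0 + j) (xs n)) = code p (j0 + j) (xs n))
      by (unfold code; now rewrite Nat.add_assoc).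
    rewrite Hcode. split.
    + rewrite (level_ancestor (2 ^ d) (fun _ => True) (fun n j => code p j (xs n)));
        [|intros; apply code_parent|exact I].
      unfold code. now rewrite En.
    + exists n. repeat split; try apply Hn. rewrite <- Hk0. now apply cell_index_coarser with j0.
Qed.

Lemma missed_null d N xs r p k0 :
  (1 <= d)%nat -> is_norm d N -> in_Pd d r -> lebesgue_null d (missed d N xs r p k0).
Proof.
  intros Hd HN Hr.
  assert (Hrpos := in_Pd_pos d r Hd Hr). destruct Hr as (Hrdec & _ & Hrdiv).
  destruct (norm_le_sup d N (norm_homog d N HN) (norm_triangle d N HN)) as (K & HK & Hsup).
  pose (D := (2 ^ d)%nat).
  assert (HD : (2 <= D)%nat).
  { unfold D. rewrite <- (Nat.pow_1_r 2) at 1. apply Nat.pow_le_mono_r; lia. }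
  assert (HDR : forall j, INR D ^ j = (2 ^ j) ^ d).
  { intros j. unfold D. rewrite pow_INR, <- !pow_mult, Nat.mul_comm. reflexivity. }
  pose (T := fun j q => exists x, missed d N xs r p k0 x /\ code p j x = q).
  assert (HT : forall j q, T (S j) q -> T j (q / D)%nat).
  { intros j q (x & Hx & <-). exists x. split; [assumption|]. symmetry. apply code_parent. }
  assert (Hp1 : 1 <= INR (S p)) by (apply (le_INR 1); lia).
  assert (Hal : 0 < / INR (S p) <= 1).
  { split; [apply Rinv_0_lt_compat; lra|]. rewrite <- Rinv_1. apply Rinv_le_contravar; lra. }
  (* Points of a common cell of generation [p + i] are at distance at most [K / 2 ^ (p + i)], which
     is below [r n] exactly when [/ 2 ^ i < rho * r n]. *)
  pose (rho := 2 ^ p / K).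
  assert (Hrho : 0 < rho) by (apply Rdiv_lt_0_compat; [apply pow_lt; lra|assumption]).
  assert (Hloss : forall j q, T j q ->
    exists J, INR (desc D T j q J) <= (1 - / INR (S p) / 4) * INR D ^ J).
  { apply (node_loses D HD T HT p p (2 ^ (d * p)) (/ INR (S p))
      (fun n => cell_index p (xs n) = k0) (fun n j => code p j (xs n))
      (fun n => (rho * r n) ^ d)).
    - apply Hal.
    - apply pow_ge_1_nat. lia.
    - intros n j _. apply code_parent.
    - intros n Hn. apply pow_lt, Rmult_lt_0_compat; [assumption|now apply Hrpos].
    - intros n Hn. apply pow_incr. split.
      + apply Rmult_le_pos; left; [assumption|apply Hrpos; lia].
      + apply Rmult_le_compat_l; [lra|now apply Hrdec].
    - intros M. destruct (Hrdiv (M / rho ^ d)) as [n Hn]. exists (S n).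
      rewrite sum_f_R0_psum in Hn.
      assert (Hrd : 0 < rho ^ d) by now apply pow_lt.
      apply Rmult_lt_compat_l with (r := rho ^ d) in Hn; [|assumption].
      replace (rho ^ d * (M / rho ^ d)) with M in Hn by (field; lra).
      rewrite <- psum_mult in Hn. eapply Rlt_le_trans; [exact Hn|].
      rewrite <- (Rmult_1_l (psum (fun k => (rho * _) ^ d) _)).
      apply psum_scale_le. intros k _. rewrite Rpow_mult_distr. lra.
    - intros n i Hpn Hn Hgood Hsmall (x & Hx & Hcode).
      destruct Hx as (Hxk & Hfar & _). specialize (Hfar n Hpn Hn).
      rewrite HDR, <- pow_inv in Hsmall. apply pow_lt_inv in Hsmall.
      2:{ apply Rmult_le_pos; left; [assumption|now apply Hrpos]. }
      apply code_inj in Hcode; [|now rewrite Hgood].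
      assert (H2p : 0 < 2 ^ p) by (apply pow_lt; lra).
      assert (H2i : 0 < 2 ^ i) by (apply pow_lt; lra).
      assert (HNle : N (fun l => x l - xs n l) <= K * / 2 ^ (p + i)).
      { apply Hsup; [|left; apply Rinv_0_lt_compat, pow_lt; lra]. intros l.
        pose proof (cell_index_bounds d (p + i) x l) as B1.
        pose proof (cell_index_bounds d (p + i) (xs n) l) as B2.
        rewrite Hcode in B1.
        assert (H2 : 0 < 2 ^ (p + i)) by (apply pow_lt; lra).
        rewrite <- (Rabs_pos_eq (/ 2 ^ (p + i))) by (left; now apply Rinv_0_lt_compat).
        replace (x l - xs n l)
          with (/ 2 ^ (p + i) * (2 ^ (p + i) * x l - 2 ^ (p + i) * xs n l)) by (field; lra).
        rewrite Rabs_mult. rewrite <- (Rmult_1_r (Rabs (/ _))) at 2.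
        apply Rmult_le_compat_l; [apply Rabs_pos|]. apply Rabs_le. lra. }
      apply Rmult_lt_compat_l with (r := K / 2 ^ p) in Hsmall.
      2:{ apply Rdiv_lt_0_compat; lra. }
      replace (K / 2 ^ p * (rho * r n)) with (r n) in Hsmall by (unfold rho; field; lra).
      replace (K * / 2 ^ (p + i)) with (K / 2 ^ p * / 2 ^ i) in HNle
        by (rewrite pow_add; field; lra).
      lra.
    - intros j0 q j (x & Hx & <-) Hj. now apply (many_cells d N xs r p k0 j0 j x). }
  apply null_of_finite_cubes; [assumption|]. intros eps Heps.
  destruct (tree_vanishing D HD T HT (1 - / INR (S p) / 4)) with (eps := eps) as [J HJ];
    [lra| |assumption|assumption|].
  { intros q (x & _ & <-). reflexivity. }
  unfold desc, count in HJ. simpl (0 + J)%nat in HJ.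
  set (cells := select (T J) (block 0 (D ^ J))) in HJ.
  (* A missed point chosen in each cell of the cover recovers the corner of that cell from its
     code. *)
  destruct (choice_fun (fun q x => missed d N xs r p k0 x /\ code p J x = q)
    (fun _ => 0) (T J)) as [g Hg]; [intros q Hq; exact Hq|].
  assert (H2 : 0 < 2 ^ (p + J)) by (apply pow_lt; lra).
  exists (/ 2 ^ (p + J)),
    (map (fun q i => / 2 ^ (p + J) * IZR (cell_index (p + J) (g q) i)) cells).
  split; [left; now apply Rinv_0_lt_compat|split].
  - rewrite length_map, pow_inv, <- HDR.
    apply Rmult_le_reg_r with (INR D ^ (p + J)); [rewrite HDR; now apply pow_lt|].
    rewrite Rmult_assoc, Rinv_l, Rmult_1_r by (rewrite HDR; apply pow_nonzero; lra).
    (* The base cube has volume [/ D ^ p], at most 1, so the proportion [eps] bounds the volume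
       too. *)
    eapply Rle_trans; [exact HJ|]. apply Rmult_le_compat_l; [lra|].
    apply Rle_pow; [apply (le_INR 1); lia|lia].
  - intros x Hx. exists (fun i => / 2 ^ (p + J) * IZR (cell_index (p + J) (g (code p J x)) i)).
    assert (HTx : T J (code p J x)) by now exists x.
    split.
    + apply in_map_iff. exists (code p J x). split; [reflexivity|].
      apply in_select. split; [|assumption]. apply in_block; [apply pow_ge_1_nat; lia|].
      apply Nat.div_small, (tree_lt D HD T HT); [|assumption].
      intros q (z & _ & <-). reflexivity.
    + destruct (Hg _ HTx) as [Hm Hc]. apply code_inj in Hc.
      2:{ now rewrite (proj1 Hm), (proj1 Hx). }
      rewrite Hc. intros i. pose proof (cell_index_bounds d (p + J) x i) as [B1 B2].
      replace (x i) with (/ 2 ^ (p + J) * (2 ^ (p + J) * x i)) by (field; lra).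
      apply Rinv_0_lt_compat in H2.
      split; [apply Rmult_le_compat_l; lra|].
      rewrite <- (Rmult_1_r (/ 2 ^ (p + J))) at 3. rewrite <- Rmult_plus_distr_l.
      apply Rmult_le_compat_l; lra.
Qed.

Theorem theorem8p3 (d : nat) (Hd : (1 <= d)%nat) (N : Rd d -> R) (HN : is_norm d N)
  (U : Rd d -> Prop) (HUo : is_open d U) (HUne : exists x, U x)
  (xs : nat -> Rd d)
  (H : ae_in d U (fun x => exists (alpha : R) (jbar : nat), 0 < alpha /\
         forall j0 j : nat, (jbar <= j0)%nat -> (jbar <= j)%nat ->
         forall k, in_cube d (Z.of_nat j0) k x ->
           card_M_ge d xs (Z.of_nat j0) k j (alpha * 2 ^ (d * j)))) :
  uniformly_eutaxic d N xs U.
Proof.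
  intros r Hr. unfold ae_in in *.
  match type of H with lebesgue_null d ?E => set (E0 := E) in H end.
  (* Index 0 is the exceptional set of the hypothesis; the others run over all constants [p] and
     base cubes. *)
  apply null_subset with (fun x => exists n, match n with
    | O => E0 x
    | S p => exists c, missed d N xs r p (zvec d c) x end).
  2:{ apply null_union. intros [|p]; [exact H|].
      apply null_union. intros c. now apply missed_null. }
  intros x [HUx Hx].
  destruct (classic (E0 x)) as [HE|HE]; [now exists 0%nat|].
  assert (Hgood : exists (alpha : R) (jbar : nat), 0 < alpha /\
    forall j0 j : nat, (jbar <= j0)%nat -> (jbar <= j)%nat ->
    forall k, in_cube d (Z.of_nat j0) k x ->
      card_M_ge d xs (Z.of_nat j0) k j (alpha * 2 ^ (d * j))).
  { apply NNPP. intros Hn. now apply HE. }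
  destruct Hgood as (alpha & jbar & Halpha & Hmany).
  apply not_all_ex_not in Hx. destruct Hx as [m Hm].
  destruct (archimed_cor1 alpha Halpha) as (a & Ha & Hapos).
  (* Large enough for the last hit at [x], for the threshold [jbar], and for
     [/ INR (S p) <= alpha]. *)
  pose (p := (m + jbar + a)%nat).
  destruct (zvec_surj d (cell_index p x)) as [c Hc].
  exists (S p), c. split; [now symmetry|split].
  - intros n Hpn Hn. apply Rnot_lt_le. intros Hlt. apply Hm.
    exists n. repeat split; [unfold p in Hpn; lia|assumption|assumption].
  - intros j0 j Hj0 Hj k Hk.
    destruct (Hmany j0 j ltac:(unfold p in *; lia) ltac:(unfold p in *; lia) k Hk)
      as (L & HL1 & HL2 & HL3).
    exists L. repeat split; try assumption.
    eapply Rle_trans; [|exact HL3]. apply Rmult_le_compat_r; [apply pow_le; lra|].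
    apply Rle_trans with (/ INR a); [|lra].
    apply Rinv_le_contravar; [now apply (lt_INR 0)|]. apply le_INR. unfold p. lia.
Qed.
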